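(* Let $\rho>0$ and for each $n\ge 1$ let $B^n_\rho=\{(\xi_1,\dots,\xi_n)\in\mathbb{R}^n:\ \sum_{1\le l\le n}|\xi_l|^2\le\rho^2\}$ be the Euclidean ball of radius $\rho$. Then for every $\tau\in\mathbb{C}$, $$\lim_{n\to\infty}\mathscr{M}_{B^n_\rho}(\tau)=\exp\{\tau\}=\sum_{0\le l<\infty}\frac{1}{\Gamma(l+1)}\,\tau^l .$$
   Context: A compact convex set $K\subset\mathbb{R}^n$ is called solid if its interior is non-empty, equivalently $\mathrm{Vol}_n(K)>0$. Let $B$ denote the closed unit Euclidean ball of $\mathbb{R}^n$ centered at the origin. By Minkowski, for $t>0$ the function $M_K(t)=\mathrm{Vol}_n(K+tB)$ is a polynomial in $t$ of degree $n$ (the Steiner-Minkowski polynomial of $K$); it is then considered for all complex $t$. Its constant coefficient is $\mathrm{Vol}_n(K)$ and its linear coefficient is the surface area $\mathrm{Vol}_{n-1}(\partial K)$. For solid $K$ the shape factor is $\sigma_K=\mathrm{Vol}_{n-1}(\partial K)/\mathrm{Vol}_n(K)>0$. The renormalized Steiner-Minkowski polynomial $\mathscr{M}_K(\tau)$ is the polynomial in $\tau$ of degree $n$ defined by $M_K(t)=\mathrm{Vol}_n(K)\cdot\mathscr{M}_K(\sigma_K t)$, i.e. $\mathscr{M}_K(\tau)=M_K(\tau/\sigma_K)/\mathrm{Vol}_n(K)$. *)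

(* Defs.v *)
From HB Require Import structures.
From mathcomp Require Import all_boot all_order all_algebra.
From mathcomp Require Import all_classical all_reals all_analysis.
From mathcomp Require Export complex.
Import Order.TTheory GRing.Theory Num.Theory.
Import numFieldNormedType.Exports.

Set Implicit Arguments.
Unset Strict Implicit.
Unset Printing Implicit Defensive.

Local Open Scope classical_set_scope.
Local Open Scope ring_scope.
Local Open Scope complex_scope.

(* R[i] with the topology of its norm |z|. *)
HB.instance Definition _ (R : realType) := NormedModule.copy R[i] R[i]^o.

(* n-dimensional Lebesgue measure, on tuples (which carry the product
   sigma-algebra), as the n-fold product of the Lebesgue measure of the line:
   R^(n+1) is identified with R * R^n via (x, t) |-> x :: t. *)
Fixpoint lebesgue_tuple (R : realType) (n : nat) :
    set (n.-tuple (measurableTypeR R)) -> \bar R :=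
  match n with
  | 0 => fun A => \d_([tuple] : 0.-tuple (measurableTypeR R)) A
  | m.+1 => fun A => (lebesgue_measure \x lebesgue_tuple (R := R) (n := m))%E
      [set p : measurableTypeR R * m.-tuple (measurableTypeR R) |
         A [tuple of p.1 :: p.2]]
  end.

(* Vol_n : Lebesgue measure transported along R^n = 'rV[R]_n. *)
Definition vol (R : realType) (n : nat) (A : set 'rV[R]_n) : \bar R :=
  lebesgue_tuple [set t : n.-tuple (measurableTypeR R) |
                    A (\row_i (tnth t i : R))].

Definition euclidean_ball (R : realType) (n : nat) (r : R) : set 'rV[R]_n :=
  [set x | \sum_(i < n) `|x 0 i| ^+ 2 <= r ^+ 2].

(* The parallel set K + t B, with B the closed Euclidean unit ball. *)
Definition parallel_set (R : realType) (n : nat) (K : set 'rV[R]_n) (t : R) :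
    set 'rV[R]_n :=
  [set x + t *: b | x in K & b in @euclidean_ball R n 1].

(* The topology of 'rV[R]_n is the usual one (it is induced by the sup norm). *)
Definition boundary (R : realType) (n : nat) (K : set 'rV[R]_n) :
    set 'rV[R]_n :=
  closure K `\` K^°.

(* The (n-1)-dimensional volume of S, as the (n-1)-dimensional Minkowski
   content: the limit as t -> 0+ of Vol_n(S + t B) / (2 t), where 2 t is the
   length of the 1-dimensional ball of radius t. On boundaries of solid compact
   convex sets it agrees with the (n-1)-dimensional Hausdorff measure. *)
Definition hypersurface_area (R : realType) (n : nat) (S : set 'rV[R]_n) : R :=
  lim (fine (vol (parallel_set S t)) / (2 * t) @[t --> 0^'+]).

(* M_K : the polynomial with M_K(t) = Vol_n(K + t B) for all t > 0. At most one
   polynomial has this property; 0 is a dummy value for the sets K for which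
   there is none. *)
Definition steiner_poly (R : realType) (n : nat) (K : set 'rV[R]_n) :
    {poly R} :=
  xget 0 [set p : {poly R} |
            forall t : R, 0 < t -> vol (parallel_set K t) = (p.[t])%:E].

Definition shape_factor (R : realType) (n : nat) (K : set 'rV[R]_n) : R :=
  hypersurface_area (boundary K) / fine (vol K).

(* M_K(tau / sigma_K) / Vol_n(K), as a polynomial in tau. *)
Definition renormalized_steiner_poly (R : realType) (n : nat)
    (K : set 'rV[R]_n) : {poly R} :=
  (fine (vol K))^-1 *: (steiner_poly K \Po ((shape_factor K)^-1 *: 'X)).

(* Value at a complex point of a polynomial with real coefficients. *)
Definition ceval (R : realType) (p : {poly R}) (z : R[i]) : R[i] :=
  (map_poly (real_complex R) p).[z].

(* exp (x + i y) = exp x * (cos y + i sin y). *)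
Definition cexp (R : realType) (z : R[i]) : R[i] :=
  (expR (complex.Re z))%:C *
  (cos (complex.Im z) +i* sin (complex.Im z)).

(* Euler's integral, for s > 0. *)
Definition Gamma (R : realType) (s : R) : R :=
  \int[lebesgue_measure]_(x in `]0, +oo[) (x `^ (s - 1) * expR (- x)).

(* Main.v *)
Require Import Defs.
From HB Require Import structures.
From mathcomp Require Import all_boot all_order all_algebra.
From mathcomp Require Import all_classical all_reals all_analysis.
From mathcomp Require Import complex measurable_realfun.
From mathcomp Require Import ring lra.
Import Order.TTheory GRing.Theory Num.Theory.
Import numFieldNormedType.Exports.

Set Implicit Arguments.
Unset Strict Implicit.
Unset Printing Implicit Defensive.

Local Open Scope classical_set_scope.
Local Open Scope ring_scope.
Local Open Scope complex_scope.

(** The Steiner polynomial of a ball of radius [rho] is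
    [vol (ball of radius rho + t) = c_n (rho + t)^n], with [c_n] the volume of
    the unit ball, and the surface area is [n c_n rho^(n-1)]; hence the shape
    factor is [n / rho], and rescaling gives [(1 + tau / n)^n] exactly
    ([renormalized_steiner_poly_ball]). The theorem is then Euler's limit for
    the exponential.

    The volumes come from slicing. A slice of an n-dimensional ball or
    spherical shell is a ball or shell in one dimension less, and integrating
    [sqrt (s - x^2)^m] over its support scales like [sqrt s^(m+1)]
    ([integral_slice]); [lebesgue_tuple_shell] iterates this. Shells are
    needed as well as balls because the surface area is a Minkowski content:
    the [t]-neighbourhood of the sphere is a shell ([parallel_sphere]).

    Euler's limit over the complex numbers ([euler_limit]) compares the n-th
    powers of [1 + tau / n] and of [exp (tau / n)], both of modulus at most
    [exp (|tau| / n)]; their difference is [o (1 / n)] because [t |-> exp (t tau)]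
    has derivative [tau] at 0. The exponential series has the same limit
    ([exp_series_limit]): its coefficients dominate those of the binomial
    expansion, so the difference of the two partial sums is bounded in modulus
    by the same difference at the nonnegative number [|tau|], which tends to 0.
    Finally [Gamma (l + 1) = l!] follows from an explicit primitive of
    [x^l exp (- x)]. *)

(** * Volumes of balls and spherical shells *)

Section VolumeOfShells.
Context {R : realType}.
Local Notation mu := (@lebesgue_measure R).
Implicit Types (m : nat) (s a b x : R).

Definition shell m a b : set (m.-tuple (measurableTypeR R)) :=
  [set t | a <= \sum_(i < m) (tnth t i : R) ^+ 2 <= b].

(** The volume, up to a constant factor, of the slice at height [x] of the ball
    of radius [sqrt s] in dimension [m + 1]. *)
Definition slice m s : R -> R := fun x => Num.sqrt (s - x ^+ 2) ^+ m.

(** The ratio of the volumes of the unit balls in dimensions [m + 1] and [m];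
    with [x = sin u] it is the integral of [cos u ^+ m.+1] over a half period. *)
Definition wallis m : R := \int[mu]_(x in `[(-1), 1]) slice m 1 x.

Fixpoint unit_ball_volume m : R :=
  if m is k.+1 then unit_ball_volume k * wallis k else 1.

Lemma slice_continuous m s : continuous (slice m s).
Proof.
move=> x; rewrite /slice.
apply: (@continuous_comp _ _ _ (fun x : R => Num.sqrt (s - x ^+ 2))
  (fun y => y ^+ m)); last exact: exprn_continuous.
apply: (@continuous_comp _ _ _ (fun x : R => s - x ^+ 2) (@Num.sqrt R));
  last exact: sqrt_continuous.
apply: cvgB; [exact: cvg_cst|exact: exprn_continuous].
Qed.

Lemma slice_ge0 m s x : 0 <= slice m s x.
Proof. by rewrite exprn_ge0 ?sqrtr_ge0. Qed.

Lemma slice_integrable m s a b :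
  mu.-integrable `[a, b] (EFin \o slice m s).
Proof.
apply: continuous_compact_integrable; first exact: segment_compact.
by apply: continuous_subspaceT; exact: slice_continuous.
Qed.

Lemma wallis_gt0 m : 0 < wallis m.
Proof.
have h : (0 : R) < 2^-1 by rewrite invr_gt0.
have : (\int[mu]_(x in `[(- 2^-1)%R, (2^-1)%R]) (2^-1 ^+ m) <= wallis m)%R.
  rewrite /wallis /Rintegral fine_le//.
  - apply: integrable_fin_num => //.
    apply: continuous_compact_integrable; first exact: segment_compact.
    by apply: continuous_subspaceT => x; exact: cvg_cst.
  - by apply: integrable_fin_num => //; exact: slice_integrable.

  apply: (@le_trans _ _ (\int[mu]_(x in `[(- 2^-1)%R, (2^-1)%R]) (slice m 1 x)%:E)%E).
    apply: ge0_le_integral => //.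
    - apply/measurable_EFinP; apply: measurable_funTS.
      by apply: continuous_measurable_fun; exact: slice_continuous.
    - move=> x; rewrite /= in_itv/= => /andP[x1 x2]; rewrite lee_fin /slice.
      apply: lerXn2r; rewrite ?nnegrE ?sqrtr_ge0// ?(ltW h)//.
      rewrite -[leLHS]gtr0_norm// -sqrtr_sqr ler_sqrt; last by nra.
      by nra.
  apply: ge0_subset_integral => //.
  - apply/measurable_EFinP; apply: measurable_funTS.
    by apply: continuous_measurable_fun; exact: slice_continuous.
  - by move=> x _; rewrite lee_fin slice_ge0.
  - move=> x; rewrite /= !in_itv/=; lra.
apply: lt_le_trans; rewrite Rintegral_cst//=.
rewrite lebesgue_measure_itv/= lte_fin gtrN// -EFinB/=.
by rewrite mulr_gt0 ?exprn_gt0// subr_gt0 gtrN.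
Qed.

Lemma unit_ball_volume_gt0 m : 0 < unit_ball_volume m.
Proof. by elim: m => //= m IH; rewrite mulr_gt0// wallis_gt0. Qed.

(** Homogeneity: the substitution [x = sqrt s * u] reduces to radius 1. *)
Lemma integral_slice m s : 0 <= s ->
  (\int[mu]_(x in `[(- Num.sqrt s)%R, (Num.sqrt s)%R]) (slice m s x)%:E)%E
  = (Num.sqrt s ^+ m.+1 * wallis m)%:E.
Proof.
rewrite le_eqVlt => /predU1P[<-|s0].
  by rewrite sqrtr0 oppr0 set_itv1 integral_set1 expr0n mul0r.
have [r r0 ->] : exists2 r : R, 0 < r & s = r ^+ 2.
  by exists (Num.sqrt s); [rewrite sqrtr_gt0|rewrite sqr_sqrtr// ltW].
rewrite sqrtr_sqr gtr0_norm// => {s s0}.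
pose F : R -> R := fun x => r * x.
have dF (x : R) : is_derive x (1 : R) F r.
  rewrite -[X in is_derive _ _ _ X]mulr1; exact: is_deriveZ.
have F' : derive1 F = cst r.
  by apply/funext => x; rewrite derive1E; apply: derive_val.
have cF : continuous F by move=> x; apply: cvgM; [exact: cvg_cst|exact: cvg_id].
rewrite (_ : `[(- r)%R, r] = `[F (-1), F 1]); last by rewrite /F mulrN1 mulr1.
rewrite integration_by_substitution_increasing//=; first last.
- by apply: continuous_subspaceT; exact: slice_continuous.
- split.
  + by move=> x _; exact: (@ex_derive _ _ _ _ _ _ _ (dF x)).
  + by apply: cvg_at_right_filter; exact: cF.
  + by apply: cvg_at_left_filter; exact: cF.
- by rewrite F'; exact: is_cvg_cst.
- by rewrite F'; exact: is_cvg_cst.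
- by rewrite F' => x _; exact: cvg_cst.
- by move=> x y _ _ xy; rewrite ltr_pM2l.
transitivity (\int[mu]_(x in `[(-1)%R, 1%R]) ((r ^+ m.+1)%:E * (slice m 1 x)%:E))%E.
  apply: eq_integral => x _; rewrite F' /= -EFinM; congr (_%:E).
  rewrite /slice; change (slice m (r ^+ 2) (r * x) * r = r ^+ m.+1 * slice m 1 x).
  rewrite /slice.
  have -> : r ^+ 2 - (r * x) ^+ 2 = r ^+ 2 * (1 - x ^+ 2) by rewrite mulrBr mulr1 exprMn.
  by rewrite sqrtrM ?sqr_ge0// sqrtr_sqr gtr0_norm// exprMn mulrAC -exprSr.
rewrite integralZl//; last exact: slice_integrable.
by rewrite /wallis /Rintegral EFinM fineK// integrable_fin_num//; exact: slice_integrable.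
Qed.

(** The volume of the closed (resp. open) ball of squared radius [s], divided by
    that of the unit ball. The two differ only for [m = 0] and [s = 0], where the
    closed ball is a point and the open one is empty; this case is the base of
    the induction in [lebesgue_tuple_shell]. Negative [s] must be allowed because
    slicing replaces [s] by [s - x ^+ 2]. *)
Definition ball_profile m s : R := if 0 <= s then Num.sqrt s ^+ m else 0.
Definition open_ball_profile m s : R := if 0 < s then Num.sqrt s ^+ m else 0.

Lemma sqr_le_itv s : 0 <= s ->
  [set x : R | x ^+ 2 <= s] = `[(- Num.sqrt s), (Num.sqrt s)]%classic.
Proof.
move=> s0; apply/seteqP; split => x /=; rewrite in_itv/= -ler_norml => h.
  by rewrite -sqrtr_sqr ler_sqrt.
by rewrite -(sqr_sqrtr s0) -[leLHS]real_normK ?num_real// lerXn2r// nnegrE ?sqrtr_ge0.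
Qed.

Lemma sqr_lt_itv s : 0 <= s ->
  [set x : R | x ^+ 2 < s] = `](- Num.sqrt s), (Num.sqrt s)[%classic.
Proof.
move=> s0; apply/seteqP; split => x /=; rewrite in_itv/= -ltr_norml => h.
  rewrite -sqrtr_sqr ltr_sqrt//; exact: le_lt_trans (sqr_ge0 x) h.
by rewrite -(sqr_sqrtr s0) -[ltLHS]real_normK ?num_real// ltrXn2r.
Qed.

Lemma ball_profileE m s :
  (fun x : R => (ball_profile m (s - x ^+ 2))%:E) =
  (fun x => (slice m s x)%:E) \_ [set x : R | x ^+ 2 <= s].
Proof.
apply/funext => x; rewrite /ball_profile patchE subr_ge0.
by case: ifPn => h; [rewrite mem_set|rewrite memNset//; apply/negP].
Qed.

Lemma open_ball_profileE m s :
  (fun x : R => (open_ball_profile m (s - x ^+ 2))%:E) =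
  (fun x => (slice m s x)%:E) \_ [set x : R | x ^+ 2 < s].
Proof.
apply/funext => x; rewrite /open_ball_profile patchE subr_gt0.
by case: ifPn => h; [rewrite mem_set|rewrite memNset//; apply/negP].
Qed.

(** One slicing step for closed balls; the support in [x] is a closed interval. *)
Lemma integral_ball_profile m s :
  (\int[mu]_x (ball_profile m (s - x ^+ 2))%:E)%E =
    (ball_profile m.+1 s * wallis m)%:E /\
  mu.-integrable setT (fun x => (ball_profile m (s - x ^+ 2))%:E).
Proof.
rewrite ball_profileE -integral_mkcond.
have [s0|s0] := leP 0 s.
  rewrite sqr_le_itv// integral_slice// /ball_profile s0; split=> //.
  by apply: (integrable_mkcond _ _).1 (slice_integrable _ _ _ _).
rewrite (_ : [set x : R | x ^+ 2 <= s] = set0); last first.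
  apply/seteqP; split=> x //= h.
  by have := lt_le_trans s0 (sqr_ge0 x); rewrite ltNge h.
rewrite integral_set0 /ball_profile leNgt s0 mul0r; split=> //.
by apply: (integrable_mkcond _ _).1 (integrable_set0 _ _).
Qed.

(** The same over an open interval, whose endpoints are negligible. *)
Lemma integral_open_ball_profile m s :
  (\int[mu]_x (open_ball_profile m (s - x ^+ 2))%:E)%E =
    (open_ball_profile m.+1 s * wallis m)%:E /\
  mu.-integrable setT (fun x => (open_ball_profile m (s - x ^+ 2))%:E).
Proof.
rewrite open_ball_profileE -integral_mkcond.
have [s0|s0] := ltP 0 s.
  rewrite sqr_lt_itv ?(ltW s0)//; split.
    rewrite -(@integral_itv_bndoo _ _ _ _ true false).
      by rewrite integral_slice ?(ltW s0)// /open_ball_profile s0.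
    apply/measurable_EFinP; apply: measurable_funTS.
    by apply: continuous_measurable_fun; exact: slice_continuous.
  apply: (integrable_mkcond _ _).1 => //.
  apply: integrableS (slice_integrable m s (- Num.sqrt s) (Num.sqrt s)) => //.
  exact: subset_itv_oo_cc.
rewrite (_ : [set x : R | x ^+ 2 < s] = set0); last first.
  apply/seteqP; split=> x //= h.
  by have := le_lt_trans (sqr_ge0 x) h; rewrite ltNge s0.
rewrite integral_set0 /open_ball_profile ltNge s0 mul0r; split=> //.
by apply: (integrable_mkcond _ _).1 (integrable_set0 _ _).
Qed.

(** Induction on the dimension: the slice at [x] of the shell with bounds [a], [b]
    is the shell with bounds [a - x ^+ 2], [b - x ^+ 2]. *)
Lemma lebesgue_tuple_shell m a b : a <= b ->
  lebesgue_tuple (@shell m a b) =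
  (unit_ball_volume m * (ball_profile m b - open_ball_profile m a))%:E.
Proof.
elim: m a b => [|m IH] a b ab.
  rewrite /= mul1r /ball_profile /open_ball_profile !expr0 diracE.
  congr (_%:E); have -> : ([tuple] \in @shell 0 a b) = (a <= 0 <= b).
    rewrite -[RHS](asboolb _); apply: asbool_equiv_eq.
    by rewrite /shell/= big_ord0.
  case: (leP a 0) => /= a0; first by rewrite subr0; case: ifP.
  by rewrite (le_trans (ltW a0) ab) subrr.
rewrite [lebesgue_tuple _]/=.
have [intb ib] := integral_ball_profile m b.
have [inta ia] := integral_open_ball_profile m a.
transitivity (\int[mu]_x ((unit_ball_volume m)%:E *
    ((ball_profile m (b - x ^+ 2)%R)%:E -
     (open_ball_profile m (a - x ^+ 2)%R)%:E)))%E.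
  apply: eq_integral => x _ /=.
  rewrite -EFinB -EFinM -IH ?lerB//; congr lebesgue_tuple.
  have sumS (t : m.-tuple (measurableTypeR R)) :
      \sum_(i < m.+1) (tnth [tuple of x :: t] i : R) ^+ 2 =
      x ^+ 2 + \sum_(i < m) (tnth t i : R) ^+ 2.
    by rewrite big_ord_recl tnth0; under eq_bigr do rewrite tnthS.
  by apply/seteqP; split => t; rewrite /xsection /shell/= inE/= sumS lerBlDl lerBrDl.
rewrite integralZl//; last exact: integrableB.
by rewrite integralB// intb inta -EFinB -EFinM -mulrBl /= -mulrA [wallis m * _]mulrC.
Qed.

Lemma vol_shell n a b : a <= b ->
  vol [set x : 'rV[R]_n | a <= \sum_(i < n) `|x 0 i| ^+ 2 <= b] =
  (unit_ball_volume n * (ball_profile n b - open_ball_profile n a))%:E.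
Proof.
move=> ab; rewrite -lebesgue_tuple_shell//; congr lebesgue_tuple.
have sumE (t : n.-tuple (measurableTypeR R)) :
    \sum_(i < n) `|(\row_i (tnth t i : R)) 0 i| ^+ 2 =
    \sum_(i < n) (tnth t i : R) ^+ 2.
  by apply: eq_bigr => i _; rewrite mxE real_normK ?num_real.
by apply/seteqP; split => t; rewrite /shell/= sumE.
Qed.

(** A ball is a shell whose inner bound is 0. *)
Lemma vol_ball n r : 0 <= r ->
  vol (@euclidean_ball R n r) = (unit_ball_volume n * r ^+ n)%:E.
Proof.
move=> r0; have := @vol_shell n 0 (r ^+ 2) (sqr_ge0 _).
rewrite /ball_profile /open_ball_profile ltxx sqr_ge0 sqrtr_sqr ger0_norm// subr0 => <-.
congr vol; apply/seteqP; split=> x /=; rewrite /euclidean_ball/=; last by case/andP.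
by move=> ->; rewrite andbT sumr_ge0// => i _; rewrite sqr_ge0.
Qed.

End VolumeOfShells.

(** * Parallel sets and surface areas of balls *)

Section Balls.
Context {R : realType}.
Implicit Types (n : nat) (rho t : R).

Definition sqnorm {n} (x : 'rV[R]_n) : R := \sum_(i < n) `|x 0 i| ^+ 2.

Lemma ballE n rho (x : 'rV[R]_n) :
  euclidean_ball rho x = (sqnorm x <= rho ^+ 2).
Proof. by []. Qed.

Lemma sqnormZ n (k : R) (x : 'rV[R]_n) : sqnorm (k *: x) = k ^+ 2 * sqnorm x.
Proof.
rewrite /sqnorm mulr_sumr; apply: eq_bigr => i _.
by rewrite mxE normrM exprMn real_normK ?num_real.
Qed.

(** Convexity of the square, coordinate by coordinate. With
    [sqnorm x <= a ^+ 2] and [sqnorm y <= b ^+ 2] the right-hand side is at most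
    [(a + b) ^+ 2], so this stands in for the triangle inequality of the
    Euclidean norm. *)
Lemma sqnormD_le n (a b : R) (x y : 'rV[R]_n) : 0 < a -> 0 < b ->
  sqnorm (x + y) <= (a + b) * (sqnorm x / a + sqnorm y / b).
Proof.
move=> a0 b0; rewrite /sqnorm !mulr_suml -big_split/= mulr_sumr.
apply: ler_sum => i _; rewrite mxE !real_normK ?num_real//.
set u := x 0 i; set v := y 0 i; rewrite -subr_ge0.
have -> : (a + b) * (u ^+ 2 / a + v ^+ 2 / b) - (u + v) ^+ 2 =
          (b * u - a * v) ^+ 2 / (a * b).
  by field; rewrite (gt_eqF a0) (gt_eqF b0).
by rewrite divr_ge0 ?sqr_ge0// mulr_ge0// ltW.
Qed.

Lemma sqnormN n (x : 'rV[R]_n) : sqnorm (- x) = sqnorm x.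
Proof. by rewrite -scaleN1r sqnormZ sqrrN expr1n mul1r. Qed.

Lemma sqnorm_continuous n : continuous (@sqnorm n).
Proof.
rewrite /sqnorm; apply: continuous_big; first exact: add_continuous.
move=> i _ x.
apply: (@continuous_comp _ _ _ (fun x : 'rV[R]_n => `|x 0 i|)
  (fun y : R => y ^+ 2)); last exact: exprn_continuous.
apply: (@continuous_comp _ _ _ (fun x : 'rV[R]_n => x 0 i)
  (fun y : R => `|y|)); last exact: norm_continuous.
exact: coord_continuous.
Qed.

(** A point of the sphere is not interior, since [k *: x] leaves the ball as soon
    as [k > 1]. *)
Lemma boundary_ball n rho : 0 < rho ->
  boundary (@euclidean_ball R n rho) = [set x | sqnorm x = rho ^+ 2].
Proof.
move=> r0; rewrite /boundary.
have cB : closed (@euclidean_ball R n rho).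
  by apply: (@preimage_closed _ _ (@sqnorm n) [set y | y <= rho ^+ 2]);
    [move=> x _; exact: sqnorm_continuous|exact: closed_le].
have oB : open [set x : 'rV[R]_n | sqnorm x < rho ^+ 2].
  by apply: (@open_comp _ _ (@sqnorm n) [set y | y < rho ^+ 2]);
    [move=> x _; exact: sqnorm_continuous|exact: open_lt].
rewrite -(closure_id _).1//; apply/seteqP; split=> x /=.
  case=> xB xI; apply/eqP; rewrite eq_le; apply/andP; split=> //.
  rewrite leNgt; apply/negP => h; apply: xI.
  rewrite /interior; apply: filterS (open_nbhs_nbhs (conj oB h)) => y /= yr.
  exact: ltW.
move=> xr; split; first by rewrite ballE xr.
move=> xI.
have : (k *: x) @[k --> (1:R)] --> 1 *: x by apply: cvgZr_tmp; exact: cvg_id.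
rewrite scale1r => /cvg_at_right_filter /(_ _ xI) xI'.
(* The interior would contain [k *: x] for some [k > 1]. *)
have near_in : \forall k \near (1 : R)^'+, (@euclidean_ball R n rho) (k *: x).
  exact: xI'.
have [k [+ k1]] := filter_ex (filterI near_in (nbhs_right_gt (1 : R))).
rewrite ballE sqnormZ xr.
rewrite -[leRHS]mul1r ler_pM2r ?exprn_gt0// -[leRHS](expr1n _ 2).
rewrite ler_sqr ?nnegrE//; last by lra.
by rewrite leNgt k1.
Qed.

(** A point of the larger ball splits as its multiples by [rho / (rho + t)] and
    [t / (rho + t)]. *)
Lemma parallel_ball n rho t : 0 < rho -> 0 < t ->
  parallel_set (@euclidean_ball R n rho) t = @euclidean_ball R n (rho + t).
Proof.
move=> r0 t0; apply/seteqP; split => [_ [x xr [b b1 <-]]|x xr].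
  move: xr b1; rewrite !ballE => xr b1.
  apply: (le_trans (sqnormD_le _ _ r0 t0)); rewrite sqnormZ expr2.
  rewrite ler_pM2l ?addr_gt0// lerD//.
    by rewrite ler_pdivrMr// -expr2.
  by rewrite ler_pdivrMr// -expr2 ler_piMr ?sqr_ge0// (le_trans b1)// expr1n.
have rt0 : 0 < rho + t by rewrite addr_gt0.
rewrite ballE in xr.
exists ((rho / (rho + t)) *: x).
  rewrite ballE sqnormZ expr_div_n mulrAC ler_pdivrMr ?exprn_gt0//.
  by rewrite ler_wpM2l// sqr_ge0.
exists ((rho + t)^-1 *: x).
  rewrite ballE sqnormZ exprVn mulrC ler_pdivrMr ?exprn_gt0//.
  by rewrite expr1n mul1r.
by rewrite scalerA -scalerDl -mulrDl divff ?scale1r// gt_eqF.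
Qed.

(** For the converse inclusion a point of the shell is moved radially onto the
    sphere; the condition [t < rho] excludes the center. *)
Lemma parallel_sphere n rho t : 0 < t -> t < rho ->
  parallel_set [set x : 'rV[R]_n | sqnorm x = rho ^+ 2] t =
  [set x | (rho - t) ^+ 2 <= sqnorm x <= (rho + t) ^+ 2].
Proof.
move=> t0 tr; have r0 : 0 < rho by apply: lt_trans tr.
have rt0 : 0 < rho - t by rewrite subr_gt0.
apply/seteqP; split => [_ [x xr [b b1 <-]]|x /= /andP[xl xu]].
  have tb : sqnorm (t *: b) / t <= t.
    rewrite sqnormZ ler_pdivrMr// -expr2 ler_piMr ?sqr_ge0//.
    by rewrite (le_trans b1)// expr1n.
  rewrite /= in xr *; apply/andP; split; last first.
    apply: (le_trans (sqnormD_le _ _ r0 t0)); rewrite expr2.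
    by rewrite ler_pM2l ?addr_gt0// lerD// xr expr2 mulfK// gt_eqF.
  rewrite leNgt; apply/negP => h.
  (* Otherwise [x = (x + t *: b) - t *: b] would have norm less than [rho]. *)
  have := sqnormD_le (x + t *: b) (- (t *: b)) rt0 t0.
  rewrite addrK xr subrK sqnormN expr2 ler_pM2l// leNgt => /negP; apply.
  rewrite -[X in _ < X](subrK t) ltr_leD//.
  by rewrite ltr_pdivrMr// -expr2.
set s := Num.sqrt (sqnorm x).
have x0 : 0 < sqnorm x by apply: lt_le_trans xl; rewrite exprn_gt0.
have s0 : 0 < s by rewrite sqrtr_gt0.
have sE : sqnorm x = s ^+ 2 by rewrite sqr_sqrtr// ltW.
have sl : rho - t <= s.
  by rewrite -(@ler_pXn2r _ 2)// ?nnegrE ?(ltW s0) ?(ltW rt0)// -sE.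
have su : s <= rho + t.
  by rewrite -(@ler_pXn2r _ 2)// ?nnegrE ?(ltW s0) ?(ltW (addr_gt0 r0 t0))// -sE.
exists ((rho / s) *: x).
  by rewrite /= sqnormZ sE expr_div_n mulfVK// expf_neq0// gt_eqF.
exists ((t^-1 * (1 - rho / s)) *: x).
  rewrite ballE sqnormZ sE -exprMn expr1n.
  have -> : t^-1 * (1 - rho / s) * s = (s - rho) / t.
    by field; rewrite !gt_eqF.
  rewrite -real_normK ?num_real// expr_le1// normrM normfV (gtr0_norm t0).
  by rewrite ler_pdivrMr// mul1r ler_norml; lra.
rewrite scalerA mulrA divff ?gt_eqF// mul1r -scalerDl addrC subrK scale1r//.
Qed.

Lemma vol_parallel_sphere n rho t : 0 < t -> t < rho ->
  vol (parallel_set [set x : 'rV[R]_n | sqnorm x = rho ^+ 2] t) =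
  (unit_ball_volume n * ((rho + t) ^+ n - (rho - t) ^+ n))%:E.
Proof.
move=> t0 tr; have r0 : 0 < rho by apply: lt_trans tr.
have rt0 : 0 < rho - t by rewrite subr_gt0.
rewrite parallel_sphere// vol_shell; last first.
  by rewrite ler_sqr ?nnegrE; lra.
rewrite /ball_profile /open_ball_profile sqr_ge0 exprn_gt0// !sqrtr_sqr.
by rewrite !gtr0_norm// addr_gt0.
Qed.

(** Dividing [(rho + t) ^+ n - (rho - t) ^+ n] by [2 * t] leaves a polynomial in
    [t], whose value at 0 is the Minkowski content. *)
Lemma hypersurface_area_sphere n rho : 0 < rho ->
  hypersurface_area (boundary (@euclidean_ball R n rho)) =
  unit_ball_volume n * (n%:R * rho ^+ n.-1).
Proof.
move=> r0; rewrite boundary_ball// /hypersurface_area.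
pose q : {poly R} := unit_ball_volume n *:
  \sum_(i < n) (rho%:P + 'X) ^+ (n.-1 - i) * (rho%:P - 'X) ^+ i.
have -> : unit_ball_volume n * (n%:R * rho ^+ n.-1) = q.[0].
  rewrite /q hornerZ horner_sum; congr (_ * _).
  rewrite (eq_bigr (fun=> rho ^+ n.-1)).
    by rewrite sumr_const card_ord mulr_natl.
  move=> i _; rewrite !hornerE subr0 -exprD subnK//.
  by case: (n) i => [[]//|m i]; rewrite -ltnS.
apply: cvg_lim => //.
apply: cvg_trans; last exact: (cvg_at_right_filter (@continuous_horner _ q 0)).
apply: near_eq_cvg; near=> t.
have t0 : 0 < t by near: t; exact: nbhs_right_gt.
have tr : t < rho by near: t; exact: nbhs_right_lt.
rewrite vol_parallel_sphere//.
change (q.[t] = unit_ball_volume n * ((rho + t) ^+ n - (rho - t) ^+ n) / (2 * t)).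
rewrite /q hornerZ horner_sum subrXX.
have -> : rho + t - (rho - t) = 2 * t by ring.
under eq_bigr do rewrite !hornerE.
by field; rewrite gt_eqF.
Unshelve. all: by end_near. Qed.

(** Two polynomials with the same values at all [t > 0] coincide, as their
    difference vanishes at all positive integers. *)
Lemma steiner_poly_ball n rho : 0 < rho ->
  steiner_poly (@euclidean_ball R n rho) =
  unit_ball_volume n *: (rho%:P + 'X) ^+ n.
Proof.
move=> r0; apply: xget_unique => [t t0|p pE].
  by rewrite parallel_ball// vol_ball ?addr_ge0 ?ltW// !hornerE.
set q := _ *: _; apply/eqP; rewrite -subr_eq0; apply/eqP.
apply: (@roots_geq_poly_eq0 _ _ [seq i.+1%:R | i <- iota 0 (size (p - q))]).
- apply/allP => _ /mapP[i _ ->]; rewrite rootE !hornerE subr_eq0.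
  have := pE i.+1%:R; rewrite ltr0Sn => /(_ isT).
  rewrite parallel_ball// vol_ball ?addr_ge0 ?ltW// => -[<-]; exact: eqxx.
- rewrite map_inj_uniq ?iota_uniq// => i j /eqP.
  by rewrite eqr_nat => /eqP[].
- by rewrite size_map size_iota.
Qed.

(** The shape factor of the ball is [n / rho]. *)
Lemma renormalized_steiner_poly_ball n rho : 0 < rho -> (0 < n)%N ->
  renormalized_steiner_poly (@euclidean_ball R n rho) =
  (1 + n%:R^-1 *: 'X) ^+ n.
Proof.
move=> r0 n0; rewrite /renormalized_steiner_poly /shape_factor.
rewrite hypersurface_area_sphere// steiner_poly_ball// vol_ball ?ltW//=.
set c := unit_ball_volume n; have c0 : c != 0 by rewrite gt_eqF ?unit_ball_volume_gt0.
have rn : rho ^+ n = rho ^+ n.-1 * rho by rewrite -exprSr prednK.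
have -> : (c * (n%:R * rho ^+ n.-1) / (c * rho ^+ n))^-1 = rho / n%:R.
  rewrite rn; field; rewrite c0 pnatr_eq0 -lt0n n0 expf_neq0 gt_eqF//.
rewrite comp_polyZ scalerA invfM mulrAC mulVf// mul1r.
rewrite rmorphXn rmorphD/= comp_polyC comp_polyX.
rewrite -scalerA.
rewrite -alg_polyC -scalerDr exprZn scalerA mulVf ?scale1r//.
by rewrite expf_neq0// gt_eqF.
Qed.
End Balls.

(** * The complex exponential *)

Section ComplexExponential.
Context {R : realType}.
Implicit Types (z w tau : R[i]) (x y t : R).

(** The norm of [R[i]] takes its values in [R[i]]; real-valued moduli make
    squeezing and comparison with real limits possible. *)
Definition modulus z : R := complex.Re `|z|.

Lemma modulusE z : (modulus z)%:C = `|z|.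
Proof. by rewrite /modulus normc_def. Qed.

Lemma modulus_ge0 z : 0 <= modulus z.
Proof. by rewrite /modulus normc_def/= sqrtr_ge0. Qed.

Lemma modulus_le_ReIm z : modulus z <= `|complex.Re z| + `|complex.Im z|.
Proof.
rewrite /modulus normc_def/=.
rewrite -[leRHS]ger0_norm ?addr_ge0// -sqrtr_sqr ler_wsqrtr// sqrrD.
rewrite !real_normK ?num_real// lerD2r lerDl mulrn_wge0// mulr_ge0//.
Qed.

Lemma modulus_real x : modulus x%:C = `|x|.
Proof. by rewrite /modulus normc_def/= expr0n/= addr0 sqrtr_sqr. Qed.

Lemma cvg_complex (u : nat -> R[i]) z :
  modulus (z - u n) @[n --> \oo] --> (0 : R) -> u @ \oo --> z.
Proof.
move=> h; apply/cvgrPdist_lt => e e0.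
have eE : e = (complex.Re e)%:C by rewrite RRe_real ?gtr0_real.
have e1 : 0 < complex.Re e by rewrite -ltcR -eE.
move/cvgrPdist_lt : h => /(_ _ e1); apply: filterS => n.
by rewrite sub0r normrN ger0_norm ?modulus_ge0// -ltcR modulusE -eE.
Qed.

Lemma cexpD z w : cexp (z + w) = cexp z * cexp w.
Proof.
case: z w => [a b] [c d]; rewrite /cexp/= expRD cosD sinD rmorphM.
rewrite mulrACA; congr (_ * _); apply/eqP; rewrite eq_complex/=.
by rewrite eqxx/= addrC [X in X + _]mulrC eqxx.
Qed.

Lemma cexp0 : cexp 0 = 1 :> R[i].
Proof. by rewrite /cexp/= expR0 cos0 sin0 mul1r. Qed.

Lemma cexpMn n z : cexp (n%:R * z) = cexp z ^+ n.
Proof.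
elim: n => [|n IH]; first by rewrite mul0r cexp0.
by rewrite -natr1 mulrDl mul1r cexpD IH exprSr.
Qed.

Lemma cexp_real x : cexp x%:C = (expR x)%:C.
Proof. by rewrite /cexp/= cos0 sin0 mulr1. Qed.

Lemma modulus_cexp z : modulus (cexp z) = expR (complex.Re z).
Proof.
rewrite /modulus /cexp normrM !normc_def/= cos2Dsin2 sqrtr1 expr0n/= addr0.
by rewrite sqrtr_sqr gtr0_norm ?expR_gt0// mulr1 mulr0 subr0.
Qed.

Lemma is_derive_mulr0 x : is_derive (0 : R) (1 : R) (fun t => t * x) x.
Proof.
have h := is_deriveM (is_derive_id (0 : R) (1 : R)) (is_derive_cst x (0 : R) (1 : R)).
by apply: (is_derive_eq h); rewrite scaler0 add0r /GRing.scale/= mulr1.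
Qed.

Lemma is_derive_comp_mulr0 (f : R -> R) x l :
  is_derive (0 : R) (1 : R) f l ->
  is_derive (0 : R) (1 : R) (fun t => f (t * x)) (x * l).
Proof.
move=> df.
have df' : is_derive (0 * x) 1 f l by rewrite mul0r.
have h := @is_derive1_comp R f (fun t => t * x) 0 l x df' (is_derive_mulr0 x).
by apply: (is_derive_eq h); rewrite mulrC.
Qed.

(** The sequence [1 / (n + 1)] tends to 0 from the right. *)
Lemma cvg_difference_quotient (f : R -> R) l :
  is_derive (0 : R) (1 : R) f l ->
  n.+1%:R * (f n.+1%:R^-1 - f 0) @[n --> \oo] --> l.
Proof.
move=> [df fl].
have : h^-1 *: ((f \o shift 0) (h *: (1 : R)) - f 0) @[h --> (0 : R)^'] --> l.
  by rewrite -fl; exact: df.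
move=> /cvg_dnbhs_at_right /cvg_at_rightP /(_ (@harmonic R)) h.
have := h (conj _ cvg_harmonic); rewrite /harmonic/=.
under [in X in _ -> X]eq_fun do rewrite -[X in X * _]invrK.
under [in X in X -> _]eq_fun do rewrite addr0 /GRing.scale/= mulr1.
by apply => n; rewrite invr_gt0.
Qed.

(** The derivative at 0 of [t |-> cexp (t * tau)] is [tau], componentwise. *)
Lemma cexp_derive0 tau :
  modulus (tau - n.+1%:R * (cexp (n.+1%:R^-1 * tau) - 1)) @[n --> \oo] --> (0 : R).
Proof.
case: tau => x y.
pose f t := expR (t * x) * cos (t * y).
pose g t := expR (t * x) * sin (t * y).
have de := is_derive_comp_mulr0 x (is_derive_expR 0).
have df : is_derive (0 : R) (1 : R) f x.
  have h := is_deriveM de (is_derive_comp_mulr0 y (is_derive_cos 0)).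
  apply: (is_derive_eq h).
  by rewrite !mul0r sin0 cos0 expR0 oppr0 mulr0 scaler0 add0r /GRing.scale/= mul1r mulr1.
have dg : is_derive (0 : R) (1 : R) g y.
  have h := is_deriveM de (is_derive_comp_mulr0 y (is_derive_sin 0)).
  apply: (is_derive_eq h).
  by rewrite !mul0r sin0 cos0 expR0 scale0r addr0 /GRing.scale/= mul1r mulr1.
have E n : (x +i* y) - n.+1%:R * (cexp (n.+1%:R^-1 * (x +i* y)) - 1) =
    (x - n.+1%:R * (f n.+1%:R^-1 - f 0)) +i* (y - n.+1%:R * (g n.+1%:R^-1 - g 0)).
  have -> : n.+1%:R = (n.+1%:R : R)%:C by rewrite rmorph_nat.
  rewrite -fmorphV /f /g /cexp !mul0r expR0 cos0 sin0.
  apply/eqP; rewrite eq_complex/=.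
  by rewrite !(mul0r, subr0, addr0, add0r, mulr0, mul1r, oppr0) !eqxx.
have F : `|x - n.+1%:R * (f n.+1%:R^-1 - f 0)| + `|y - n.+1%:R * (g n.+1%:R^-1 - g 0)|
    @[n --> \oo] --> (0 : R).
  rewrite -[X in _ --> X](addr0 0).
  apply: cvgD; rewrite -[X in _ --> X](normr0 R); apply: cvg_norm.
    rewrite -[X in _ --> X](subrr x); apply: cvgB; first exact: cvg_cst.
    exact: cvg_difference_quotient.
  rewrite -[X in _ --> X](subrr y); apply: cvgB; first exact: cvg_cst.
  exact: cvg_difference_quotient.
apply: squeeze_cvgr (cvg_cst 0) F.
by apply: nearW => n; rewrite modulus_ge0 E (le_trans (modulus_le_ReIm _)).
Qed.

(** Telescoping factorization of [a ^+ n - b ^+ n]. *)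
Lemma norm_subXn_le (K : numDomainType) (a b M : K) n :
  `|a| <= M -> `|b| <= M -> `|a ^+ n - b ^+ n| <= `|a - b| * (n%:R * M ^+ n.-1).
Proof.
move=> aM bM; rewrite subrXX normrM ler_wpM2l//.
apply: le_trans (ler_norm_sum _ _ _) _.
have -> : n%:R * M ^+ n.-1 = \sum_(i < n) M ^+ n.-1.
  by rewrite sumr_const card_ord mulr_natl.
apply: ler_sum => i _.
have M0 : 0 <= M by apply: le_trans aM.
have -> : M ^+ n.-1 = M ^+ (n.-1 - i) * M ^+ i.
  by rewrite -exprD subnK//; case: (n) i => [[]//|m i]; rewrite -ltnS.
by rewrite normrM !normrX ler_pM ?exprn_ge0// lerXn2r ?nnegrE.
Qed.

(** [norm_subXn_le] with [a = cexp (tau / (n + 1))], [b = 1 + tau / (n + 1)]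
    and [M = expR (modulus tau / (n + 1))]: the factor [n + 1] is absorbed by
    [cexp_derive0], and [M ^+ n] is at most [expR (modulus tau)]. *)
Lemma euler_limit tau :
  modulus (cexp tau - (1 + n.+1%:R^-1 * tau) ^+ n.+1) @[n --> \oo] --> (0 : R).
Proof.
have F : modulus (tau - n.+1%:R * (cexp (n.+1%:R^-1 * tau) - 1)) * expR (modulus tau)
    @[n --> \oo] --> (0 : R).
  rewrite -[X in _ --> X](mul0r (expR (modulus tau))).
  by apply: cvgM; [exact: cexp_derive0|exact: cvg_cst].
apply: squeeze_cvgr (cvg_cst 0) F; apply: nearW => n; rewrite modulus_ge0/=.
set M : R := expR (n.+1%:R^-1 * modulus tau).
have nC : n.+1%:R = (n.+1%:R : R)%:C by rewrite rmorph_nat.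
have n0 : (n.+1%:R : R[i]) != 0 by rewrite pnatr_eq0.
have -> : cexp tau = cexp (n.+1%:R^-1 * tau) ^+ n.+1.
  by rewrite -cexpMn mulrA divff// mul1r.
have modn : `|n.+1%:R^-1 * tau| = (n.+1%:R^-1 * modulus tau)%:C.
  by rewrite normrM normfV normr_nat -modulusE nC -fmorphV -rmorphM.
rewrite -lecR modulusE.
apply: (@le_trans _ _ (`|cexp (n.+1%:R^-1 * tau) - (1 + n.+1%:R^-1 * tau)| *
   (n.+1%:R * M%:C ^+ n))).
  apply: norm_subXn_le.
    rewrite -modulusE lecR modulus_cexp ler_expR -lecR -modn.
    apply: le_trans (normc_ge_Re _); rewrite lecR; exact: ler_norm.
  apply: le_trans (ler_normD _ _) _.
  by rewrite normr1 modn -(rmorph1 (real_complex R)) -rmorphD lecR expR_ge1Dx.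
have -> : `|cexp (n.+1%:R^-1 * tau) - (1 + n.+1%:R^-1 * tau)| * (n.+1%:R * M%:C ^+ n) =
    (modulus (tau - n.+1%:R * (cexp (n.+1%:R^-1 * tau) - 1)) * M ^+ n)%:C.
  rewrite rmorphM rmorphXn/= modulusE mulrA; congr (_ * _).
  rewrite -[X in _ * X](normr_nat (R[i]) n.+1) -normrM distrC; congr (`|_|).
  have tauE : tau = n.+1%:R * (n.+1%:R^-1 * tau) by rewrite mulrA divff// mul1r.
  by rewrite [X in _ = _ - X]tauE mulrC -mulrBr opprD addrA.
rewrite lecR ler_wpM2l ?modulus_ge0//.
have -> : expR (modulus tau) = M ^+ n.+1.
  by rewrite -expRM_natl mulrA divff ?mul1r// pnatr_eq0.
by apply: ler_weXn2l => //; rewrite -expR0 ler_expR mulr_ge0 ?invr_ge0 ?modulus_ge0.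
Qed.

Lemma euler_limit_real x : 0 <= x ->
  (1 + n.+1%:R^-1 * x) ^+ n.+1 @[n --> \oo] --> expR x.
Proof.
move=> x0; apply/cvgrPdist_lt => e e0.
move/cvgrPdist_lt : (euler_limit x%:C) => /(_ _ e0); apply: filterS => n.
rewrite sub0r normrN ger0_norm ?modulus_ge0// -modulus_real.
by rewrite rmorphB rmorphXn rmorphD rmorphM fmorphV rmorph_nat rmorph1 cexp_real.
Qed.

Lemma ffact_le_expn (n l : nat) : (n ^_ l <= n ^ l)%N.
Proof.
elim: l => // l IH; rewrite ffactnSr expnSr leq_mul//; exact: leq_subr.
Qed.

(** The coefficients of the exponential series dominate those of
    [(1 + w / (n + 1)) ^+ n.+1]. *)
Lemma binomial_coef_le (n l : nat) :
  'C(n.+1, l)%:R * (n.+1%:R^-1 : R) ^+ l <= l`!%:R^-1.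
Proof.
rewrite exprVn ler_pdivrMr ?exprn_gt0// mulrC ler_pdivlMr ?ltr0n ?fact_gt0//.
by rewrite -natrM -natrX ler_nat bin_ffact ffact_le_expn.
Qed.

Lemma exp_series_sub_eulerE (K : numFieldType) (w : K) n :
  \sum_(0 <= l < n.+2) l`!%:R^-1 * w ^+ l - (1 + n.+1%:R^-1 * w) ^+ n.+1 =
  \sum_(0 <= l < n.+2) (l`!%:R^-1 - 'C(n.+1, l)%:R * n.+1%:R^-1 ^+ l) * w ^+ l.
Proof.
rewrite [1 + _]addrC exprD1n -(big_mkord xpredT (fun l => _ ^+ l *+ 'C(n.+1, l))).
rewrite -sumrB; apply: eq_bigr => l _.
by rewrite mulrBl exprMn -(mulr_natl (_ * _)) mulrA.
Qed.

(** The coefficients of the difference are nonnegative, so the triangle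
    inequality reduces to the argument [modulus tau]. *)
Lemma modulus_exp_series_sub_euler_le tau n :
  modulus (\sum_(0 <= l < n.+2) l`!%:R^-1 * tau ^+ l -
           (1 + n.+1%:R^-1 * tau) ^+ n.+1) <=
  \sum_(0 <= l < n.+2) l`!%:R^-1 * modulus tau ^+ l -
  (1 + n.+1%:R^-1 * modulus tau) ^+ n.+1.
Proof.
rewrite -lecR modulusE !exp_series_sub_eulerE rmorph_sum/=.
apply: le_trans (ler_norm_sum _ _ _) _; apply: ler_sum => l _.
rewrite normrM normrX rmorphM rmorphXn/= modulusE ler_wpM2r//.
have -> : l`!%:R^-1 - 'C(n.+1, l)%:R * n.+1%:R^-1 ^+ l =
    (l`!%:R^-1 - 'C(n.+1, l)%:R * n.+1%:R^-1 ^+ l : R)%:C :> R[i].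
  by rewrite rmorphB rmorphM rmorphXn !fmorphV !rmorph_nat.
by rewrite -modulusE modulus_real lecR ger0_norm// subr_ge0 binomial_coef_le.
Qed.

(** At a nonnegative real both the partial sums and Euler's powers tend to [expR],
    so their difference tends to 0, and by [modulus_exp_series_sub_euler_le] the
    same holds at [tau]. *)
Lemma exp_series_limit tau :
  \sum_(0 <= l < m) l`!%:R^-1 * tau ^+ l @[m --> \oo] --> cexp tau.
Proof.
set r := modulus tau.
have Sr : \sum_(0 <= l < n.+2) l`!%:R^-1 * r ^+ l @[n --> \oo] --> expR r.
  have := is_cvg_series_exp_coeff r : series (exp_coeff r) @ \oo --> expR r.
  by rewrite -cvg_shiftS -cvg_shiftS exp_coeffE.
rewrite -(@cvg_shiftS _ (fun m => \sum_(0 <= l < m) l`!%:R^-1 * tau ^+ l)).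
rewrite -(@cvg_shiftS _ (fun m => \sum_(0 <= l < m.+1) l`!%:R^-1 * tau ^+ l)).
apply: cvg_complex => /=.
have F : modulus (cexp tau - (1 + n.+1%:R^-1 * tau) ^+ n.+1) +
    (\sum_(0 <= l < n.+2) l`!%:R^-1 * r ^+ l - (1 + n.+1%:R^-1 * r) ^+ n.+1)
    @[n --> \oo] --> (0 : R).
  rewrite -[X in _ --> X](addr0 0); apply: cvgD; first exact: euler_limit.
  rewrite -[X in _ --> X](subrr (expR r)); apply: cvgB => //.
  by apply: euler_limit_real; rewrite modulus_ge0.
apply: squeeze_cvgr (cvg_cst 0) F; apply: nearW => n; rewrite modulus_ge0/=.
apply: le_trans (lerD (lexx _) (modulus_exp_series_sub_euler_le tau n)).
rewrite -lecR rmorphD/= !modulusE [X in _ <= _ + X]distrC.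
by apply: le_trans (ler_normD _ _); rewrite addrA subrK.
Qed.

End ComplexExponential.

(** * Factorials as values of the Gamma function *)

Section GammaFactorial.
Context {R : realType}.
Local Notation mu := (@lebesgue_measure R).
Implicit Types (l k : nat) (x : R).

(** From [expR x >= x ^+ k.+1 / k.+1`!]. *)
Lemma cvg_expn_expRN k : x ^+ k * expR (- x) @[x --> +oo] --> (0 : R).
Proof.
apply/cvgrPdist_le => e e0; near=> x.
have x1 : 0 < x by near: x; exact: nbhs_pinfty_gt.
have xe : (k.+1)`!%:R / e <= x by near: x; apply: nbhs_pinfty_ge; exact: num_real.
rewrite sub0r normrN ger0_norm ?mulr_ge0 ?exprn_ge0 ?expR_ge0 ?(ltW x1)//.
rewrite expRN ler_pdivrMr ?expR_gt0//.
apply: (@le_trans _ _ (e * (x ^+ k.+1 / (k.+1)`!%:R))); last first.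
  rewrite ler_pM2l//; apply: le_trans (expR_ge1Dxn k (ltW x1)).
  by rewrite lerDr.
move: xe; rewrite ler_pdivrMr// => xe.
rewrite mulrA ler_pdivlMr ?ltr0n ?fact_gt0// exprS mulrA [leLHS]mulrC.
by rewrite ler_pM2r ?exprn_gt0// mulrC.
Unshelve. all: by end_near. Qed.

(** [gamma_poly l] is the sum of [l! / k! X^k] over [k <= l]; iterated integration
    by parts yields [- gamma_poly l * expR (- x)] as a primitive of
    [x ^+ l * expR (- x)]. *)
Fixpoint gamma_poly l : {poly R} :=
  if l is k.+1 then 'X^(k.+1) + k.+1%:R *: gamma_poly k else 1.

Lemma gamma_polyB_deriv l : gamma_poly l - (gamma_poly l)^`() = 'X^l.
Proof.
elim: l => [|l IH]; first by rewrite /= derivC subr0 expr0.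
rewrite /= derivD derivXn derivZ /=.
rewrite opprD addrACA -scalerBr IH -mulr_natl -polyC_natr mul_polyC.
by rewrite addrNK.
Qed.

Lemma gamma_poly0 l : (gamma_poly l).[0] = l`!%:R.
Proof.
elim: l => [|l IH]; first by rewrite hornerC.
by rewrite /= !hornerE IH expr0n/= add0r factS natrM.
Qed.

Definition gamma_primitive l x := - ((gamma_poly l).[x] * expR (- x)).

Lemma cvg_gamma_primitive l : gamma_primitive l x @[x --> +oo] --> (0 : R).
Proof.
rewrite /gamma_primitive -oppr0; apply: cvgN.
elim: l => [|l IH] /=.
  have := cvg_expn_expRN 0; apply: cvg_trans; apply: near_eq_cvg.
  by apply: nearW => x; rewrite hornerC expr0.
have -> : (fun x => ('X^(l.+1) + l.+1%:R *: gamma_poly l).[x] * expR (- x)) =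
    (fun x => x ^+ l.+1 * expR (- x) + l.+1%:R * ((gamma_poly l).[x] * expR (- x))).
  by apply/funext => x; rewrite hornerD hornerXn hornerZ mulrDl mulrA.
rewrite -[X in _ --> X](addr0 0) -[X in _ --> _ + X](mulr0 l.+1%:R).
apply: cvgD; first exact: cvg_expn_expRN.
by apply: cvgM => //; exact: cvg_cst.
Qed.

Lemma is_derive_gamma_primitive l x : is_derive x (1 : R) (gamma_primitive l) (x ^+ l * expR (- x)).
Proof.
have de : is_derive x (1 : R) (fun t : R => expR (- t)) (- expR (- x)).
  have dN : is_derive x (1 : R) (fun t : R => - t) (- 1) by exact: is_deriveN.
  have h := @is_derive1_comp R expR (fun t => - t) x _ _ (is_derive_expR (- x)) dN.
  by apply: (is_derive_eq h); rewrite mulrN1.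
have h := is_deriveN (is_deriveM (is_derive_poly (gamma_poly l) x) de).
apply: (is_derive_eq h).
rewrite -hornerXn -gamma_polyB_deriv hornerD hornerN /GRing.scale/=.
ring.
Qed.

Lemma Gamma_factorial l : Gamma (l%:R + 1 : R) = l`!%:R.
Proof.
rewrite /Gamma addrK.
have cf : continuous (fun x : R => x ^+ l * expR (- x)).
  move=> x; apply: cvgM; first exact: exprn_continuous.
  apply: (@continuous_comp _ _ _ (fun x : R => - x) (@expR R));
    last exact: continuous_expR.
  exact: opp_continuous.
transitivity (\int[mu]_(x in `]0%R, +oo[) (x ^+ l * expR (- x))).
  apply: eq_Rintegral => x; rewrite inE/= in_itv/= andbT => x0.
  by rewrite powR_mulrn// ltW.
rewrite /Rintegral integral_itv_obnd_cbnd; last first.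
  apply/measurable_EFinP; apply: measurable_funTS.
  exact: continuous_measurable_fun.
have h := @Rintegral_ge0_continuous_FTC2y R (fun x => x ^+ l * expR (- x)) (gamma_primitive l) 0 0.
rewrite /Rintegral in h; rewrite h.
- by rewrite sub0r /gamma_primitive opprK gamma_poly0 oppr0 expR0 mulr1.
- by move=> x x0; rewrite mulr_ge0 ?exprn_ge0// expR_ge0.
- exact: continuous_subspaceT.
- exact: cvg_gamma_primitive.
- by move=> x _; exact: (@ex_derive _ _ _ _ _ _ _ (is_derive_gamma_primitive l x)).
- apply: cvg_at_right_filter; apply: differentiable_continuous.
  by apply/derivable1_diffP; exact: (@ex_derive _ _ _ _ _ _ _ (is_derive_gamma_primitive l 0)).
- by move=> x _; rewrite derive1E; exact: (@derive_val _ _ _ _ _ _ _ (is_derive_gamma_primitive l x)).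
Qed.

End GammaFactorial.

(** * The limit *)

Theorem mainTheorem4 (R : realType) (rho : R) (hrho : 0 < rho) (tau : R[i]) :
  (ceval (renormalized_steiner_poly (@euclidean_ball R n rho)) tau
     @[n --> \oo] --> cexp tau) /\
  ((\sum_(0 <= l < m) ((Gamma (l%:R + 1 : R))^-1)%:C * tau ^+ l)
     @[m --> \oo] --> cexp tau).
Proof.
split; last first.
  have -> : (fun m => \sum_(0 <= l < m) ((Gamma (l%:R + 1 : R))^-1)%:C * tau ^+ l) =
      (fun m => \sum_(0 <= l < m) l`!%:R^-1 * tau ^+ l).
    apply/funext => m; apply: eq_bigr => l _.
    by rewrite Gamma_factorial fmorphV rmorph_nat.
  exact: exp_series_limit.
(* The case n = 0 is degenerate and does not affect the limit. *)
rewrite -(@cvg_shiftS _ (fun n =>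
  ceval (renormalized_steiner_poly (@euclidean_ball R n rho)) tau)).
apply: cvg_complex.
have -> : (fun n => modulus (cexp tau -
      ceval (renormalized_steiner_poly (@euclidean_ball R n.+1 rho)) tau)) =
    (fun n => modulus (cexp tau - (1 + n.+1%:R^-1 * tau) ^+ n.+1)).
  apply/funext => n; rewrite /ceval renormalized_steiner_poly_ball//.
  rewrite rmorphXn rmorphD rmorph1/= map_polyZ map_polyX !hornerE /=.
  by rewrite fmorphV rmorph_nat.
exact: euler_limit.
Qed.
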